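(* Let $\lambda$ be a partition, $n\in N(\lambda)$ and $k\ge1$. Then the polynomial $\mathrm{ss}_{\lambda,n}(x_1,\dots,x_k)$ has saturated Newton polytope, i.e. $\mathrm{New}(f)\cap\mathbb Z_{\ge0}^k=\mathrm{supp}\,f$ for $f=\mathrm{ss}_{\lambda,n}(x_1,\dots,x_k)$.
   Context: $N(\lambda)=\{n\ge|\lambda|: n\equiv|\lambda|\pmod 2\}$. For $f=\sum_a c_ax^a\in\mathbb Z[x_1,\dots,x_k]$, $\mathrm{supp}\,f=\{a\in\mathbb Z_{\ge0}^k: c_a\ne0\}$ and $\mathrm{New}(f)\subseteq\mathbb R^k$ is the convex hull of $\mathrm{supp}\,f$. A skew shape is a horizontal strip if it has at most one box in each column. An SSOT of shape $\lambda$ is a sequence of partitions $S=(S^1,S'^2,S^2,S'^3,\dots)$ such that, with $S^0=S'^1=\emptyset$: for all $i\ge1$, $S'^i\subseteq S^{i-1}$, $S'^i\subseteq S^i$, and $S^{i-1}/S'^i$, $S^i/S'^i$ are horizontal strips (possibly empty); and $S^i=S'^{i+1}=\lambda$ for all large $i$. Put $m_i(S)=|S^{i-1}/S'^i|+|S^i/S'^i|$, length $n=\sum_i m_i(S)$, $x^S=\prod_ix_i^{m_i(S)}$. $\mathrm{ss}_{\lambda,n}(x)=\sum x^S$ over SSOTs of shape $\lambda$ and length $n$, and $\mathrm{ss}_{\lambda,n}(x_1,\dots,x_k)$ is its specialization at $x_{k+1}=x_{k+2}=\dots=0$. *)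

(* Defs.v *)
From HB Require Import structures.
From mathcomp Require Import all_boot all_order all_algebra.
From mathcomp Require Import boolp classical_sets functions cardinality fsbigop.
From mathcomp Require Import reals mpoly zify.

Set Implicit Arguments.
Unset Strict Implicit.
Unset Printing Implicit Defensive.

Import Order.TTheory GRing.Theory Num.Theory.

Local Open Scope classical_set_scope.
Local Open Scope ring_scope.

Definition is_intpart (s : seq nat) : bool := sorted geq s && (0%N \notin s).

Record intpart := IntPart { parts :> seq nat; _ : is_intpart parts }.

HB.instance Definition _ := [isSub for parts].
HB.instance Definition _ := [Countable of intpart by <:].

Definition empty_part : intpart := @IntPart [::] isT.

Definition part_size (la : intpart) : nat := sumn la.

(* Rows and columns are numbered from 0; rows beyond the last part are empty. *)
Definition row_len (la : intpart) (i : nat) : nat := nth 0%N la i.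

Definition part_incl (mu la : intpart) : Prop :=
  forall i, (row_len mu i <= row_len la i)%N.

Definition skew_box (la mu : intpart) (i j : nat) : bool :=
  (row_len mu i <= j < row_len la i)%N.

Definition horizontal_strip (la mu : intpart) : Prop :=
  forall j i1 i2, skew_box la mu i1 j -> skew_box la mu i2 j -> i1 = i2.

(* Number of boxes of la/mu; meaningful when mu is contained in la. *)
Definition skew_size (la mu : intpart) : nat :=
  (part_size la - part_size mu)%N.

(* The sequence (S^1, S'^2, S^2, S'^3, ...), extended by S^0 and S'^1, is
   encoded by the function S with S i = (S^i, S'^(i+1)). *)
Definition part_seq := nat -> intpart * intpart.

Record is_ssot (la : intpart) (S : part_seq) : Prop := IsSsot {
  ssot_start : S 0%N = (empty_part, empty_part);
  ssot_down_incl : forall i, part_incl (S i).2 (S i).1;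
  ssot_up_incl : forall i, part_incl (S i).2 (S i.+1).1;
  ssot_down_strip : forall i, horizontal_strip (S i).1 (S i).2;
  ssot_up_strip : forall i, horizontal_strip (S i.+1).1 (S i).2;
  ssot_stable : exists N, forall i, (N <= i)%N -> S i = (la, la)
}.

(* With the indexing above, ssot_mult S i is m_(i+1)(S), the exponent of
   x_(i+1), which is the variable 'X_i of {mpoly int[k]} when i < k. *)
Definition ssot_mult (S : part_seq) (i : nat) : nat :=
  (skew_size (S i).1 (S i).2 + skew_size (S i.+1).1 (S i).2)%N.

Definition ssot_length (S : part_seq) : nat :=
  \sum_(i \in [set: nat]) ssot_mult S i.

Definition ssot (la : intpart) (n : nat) : set part_seq :=
  [set S | is_ssot la S /\ ssot_length S = n].

(* x^S at x_(k+1) = x_(k+2) = ... = 0. *)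
Definition ssot_monomial (k : nat) (S : part_seq) : {mpoly int[k]} :=
  if `[< forall i, (k <= i)%N -> ssot_mult S i = 0%N >]
  then 'X_[ [multinom ssot_mult S i | i < k] ]
  else 0.

(* ss_(la,n)(x_1, ..., x_k). The sum may range over infinitely many SSOTs, of
   which only finitely many contribute (ssot_monomial_finite below), so it is not the
   default value of \sum_(_ \in _) on families with infinite support. *)
Definition ss_poly (la : intpart) (n k : nat) : {mpoly int[k]} :=
  \sum_(S \in ssot la n) ssot_monomial k S.

Section Newton.
Variables (R : realType) (k : nat).

Definition convex_hull (X : set 'rV[R]_k) : set 'rV[R]_k :=
  [set x | exists (m : nat) (w : 'I_m -> R) (p : 'I_m -> 'rV[R]_k),
     [/\ forall i, 0 <= w i, \sum_i w i = 1, forall i, X (p i)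
       & x = \sum_i w i *: p i]].

Definition exponent_vector (a : 'X_{1..k}) : 'rV[R]_k := \row_i (a i)%:R.

Definition nat_points : set 'rV[R]_k := range exponent_vector.

Definition supp (f : {mpoly int[k]}) : set 'rV[R]_k :=
  [set exponent_vector a | a in [set a | f@_a != 0]].

Definition newton (f : {mpoly int[k]}) : set 'rV[R]_k := convex_hull (supp f).

Definition saturated_newton_polytope (f : {mpoly int[k]}) : Prop :=
  newton f `&` nat_points = supp f.

End Newton.

Lemma intpartP (la : intpart) : is_intpart la. Proof. exact: valP. Qed.

Lemma eq_intpart (la mu : intpart) : row_len la =1 row_len mu -> la = mu.
Proof.
suff nth_size (a b : intpart) : row_len a =1 row_len b -> (size a <= size b)%N.
  move=> eqn; apply/val_inj/(@eq_from_nth _ 0%N); last by move=> i _; exact: eqn.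
  by apply/eqP; rewrite eqn_leq !nth_size// => i; rewrite eqn.
move=> eqn; rewrite leqNgt; apply/negP => lt_ba.
have /andP[_ /negP] := intpartP a; apply.
have <- : row_len a (size b) = 0%N by rewrite eqn /row_len nth_default.
exact: mem_nth.
Qed.

Lemma sumn_nth (s : seq nat) N :
  (size s <= N)%N -> sumn s = (\sum_(i < N) nth 0 s i)%N.
Proof.
elim: s N => [|x s IH] [|N]//= sN; first by rewrite big_ord0.
  by rewrite big1// => i _; rewrite nth_nil.
by rewrite big_ord_recl (IH N).
Qed.

Lemma part_incl_size (mu la : intpart) :
  part_incl mu la -> (part_size mu <= part_size la)%N.
Proof.
move=> le_mu; have lmax := leq_maxl (size mu) (size la).
rewrite /part_size (sumn_nth lmax) (sumn_nth (leq_maxr (size mu) (size la))).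
by apply: leq_sum => i _; exact: le_mu.
Qed.

Lemma part_incl_eq (mu la : intpart) :
  part_incl mu la -> skew_size la mu = 0%N -> la = mu.
Proof.
move=> le_mu /eqP; rewrite subn_eq0 => le_la; apply: eq_intpart => i.
set N := maxn i.+1 (maxn (size mu) (size la)).
have [iN mN lN] : [/\ i < N, size mu <= N & size la <= N]%N.
  by rewrite !leq_max !leqnn !orbT.
move: le_la; rewrite /part_size (sumn_nth mN) (sumn_nth lN).
rewrite (bigD1 (Ordinal iN))//= [leqRHS](bigD1 (Ordinal iN))//=.
have : (\sum_(j < N | j != Ordinal iN) nth 0 mu j <=
        \sum_(j < N | j != Ordinal iN) nth 0 la j)%N.
  by apply: leq_sum => j _; exact: le_mu.
have := le_mu i; rewrite /row_len.
by move: (\sum_(_ < _ | _) _)%N (\sum_(_ < _ | _) _)%N => A B; lia.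
Qed.

Lemma part_bounds (la : intpart) n : (part_size la <= n)%N ->
  (size la <= n)%N /\ {in parts la, forall x, (x < n.+1)%N}.
Proof.
have /andP[_] := intpartP la; rewrite /part_size.
elim: (parts la) n => [|x s IH] n//=; rewrite inE negb_or => /andP[x0 s0] xsn.
have [|size_s lt_s] := IH (n - x)%N s0; first by lia.
split=> [|y]; first by move: x0; lia.
by rewrite inE => /orP[/eqP->|/lt_s]; lia.
Qed.

Lemma ssot_mult_support la S : is_ssot la S ->
  finite_set ([set: nat] `&` ssot_mult S @^-1` [set~ 0%N]).
Proof.
move=> [_ _ _ _ _ [N S_la]]; apply: (sub_finite_set _ (finite_II N)) => i /=.
rewrite ltnNge => -[_ mi]; apply/negP => Ni; apply: mi.
by rewrite /ssot_mult !S_la ?(leqW Ni)//= /skew_size subnn.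
Qed.

Lemma ssot_lengthE la S N : is_ssot la S ->
  (forall i, (N <= i)%N -> ssot_mult S i = 0%N) ->
  ssot_length S = (\sum_(i < N) ssot_mult S i)%N.
Proof.
move=> Sla m0; rewrite /ssot_length -(fsbig_widen `I_N)//=; first by rewrite -fsbig_ord.
by move=> i /= [_ /negP]; rewrite -leqNgt => /m0.
Qed.

Lemma ssot_part_size la S k : is_ssot la S ->
  (forall i, (k <= i)%N -> ssot_mult S i = 0%N) ->
  forall i, (part_size (S i).1 <= ssot_length S)%N.
Proof.
move=> Sla m0 i; rewrite (@ssot_lengthE _ _ (maxn k i) Sla); last first.
  by move=> j; rewrite geq_max => /andP[/m0].
suff partial j : (part_size (S j).1 <= \sum_(h < j) ssot_mult S h)%N.
  apply: (leq_trans (partial i)).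
  rewrite -!(big_mkord xpredT (ssot_mult S)).
  by rewrite (big_cat_nat (leq0n i) (leq_maxr k i))/= leq_addr.
elim: j => [|j IH]; first by rewrite (ssot_start Sla).
rewrite big_ord_recr /=; move: IH; move: (\sum_(_ < _) _)%N => m.
have := part_incl_size (ssot_down_incl Sla j).
have := part_incl_size (ssot_up_incl Sla j).
by rewrite /ssot_mult /skew_size; lia.
Qed.

Lemma ssot_stable_ge la S k : is_ssot la S ->
  (forall i, (k <= i)%N -> ssot_mult S i = 0%N) ->
  forall i, (k <= i)%N -> S i = (la, la).
Proof.
move=> Sla m0.
have step i : (k <= i)%N -> (S i).1 = (S i).2 /\ (S i.+1).1 = (S i).2.
  move=> /m0 /eqP; rewrite addn_eq0 => /andP[/eqP d0 /eqP u0].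
  by split; apply: part_incl_eq => //; apply Sla.
have [N S_la] := ssot_stable Sla.
suff back d i : (k <= i)%N -> S (d + i)%N = (la, la) -> S i = (la, la).
  by move=> i ki; apply: (back N) => //; apply: S_la; rewrite leq_addr.
move=> ki; elim: d => // d IH; rewrite addSn => Sd; apply: IH.
have [e1 e2] := step (d + i)%N (leq_trans ki (leq_addl _ _)).
by rewrite [LHS]surjective_pairing e1 -e2 Sd.
Qed.

Lemma ssot_monomial_finite la n k :
  finite_set (ssot la n `&` ssot_monomial k @^-1` [set~ 0]).
Proof.
pose part (b : {bseq n of 'I_n.+1}) : intpart :=
  insubd empty_part (map val b).
pose seq_of (g : {ffun 'I_k -> {bseq n of 'I_n.+1} * {bseq n of 'I_n.+1}}) :
    part_seq :=
  fun i => if insub i is Some j then (part (g j).1, part (g j).2) else (la, la).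
have partK (mu : intpart) : (part_size mu <= n)%N -> exists b, part b = mu.
  move=> /part_bounds[size_mu lt_mu].
  have szb : (size [seq inord x : 'I_n.+1 | x <- mu] <= n)%N by rewrite size_map.
  exists (Bseq szb); rewrite /part /= -map_comp.
  suff -> : [seq (val \o inord (n' := n)) x | x <- mu] = mu :> seq nat.
    by rewrite -[X in insubd _ X]/(val mu) valKd.
  by rewrite map_id_in// => x /lt_mu ltx /=; rewrite inordK.
apply: (@sub_finite_set _ _ (range seq_of)); last first.
  by apply: finite_image; exact: finite_finset.
move=> S [[Sla lenS]]; rewrite /= /ssot_monomial.
case: asboolP => [m0 _|_ /(_ erefl)//].
have bnd1 i : (part_size (S i).1 <= n)%N.
  by rewrite -lenS; exact: (ssot_part_size Sla m0).
have bnd2 i : (part_size (S i).2 <= n)%N.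
  exact: leq_trans (part_incl_size (ssot_down_incl Sla i)) (bnd1 i).
pose b1 i := sval (cid (partK _ (bnd1 i))).
pose b2 i := sval (cid (partK _ (bnd2 i))).
exists [ffun j : 'I_k => (b1 j, b2 j)] => //.
apply/funext => i; rewrite /seq_of; case: insubP => [j _ ji|].
  rewrite ffunE /= ji [RHS]surjective_pairing.
  by rewrite (svalP (cid (partK _ (bnd1 i)))) (svalP (cid (partK _ (bnd2 i)))).
by rewrite -leqNgt => ki; rewrite (ssot_stable_ge Sla m0 ki).
Qed.

(* Main.v *)
(** The exponents of [ss_(la,n)(x_1, ..., x_k)], with [n = |la| + 2d], are exactly the
    vectors [b >= 0] of total [n] such that, for each set [I] of [j] variables,
    [sum_(i in I) b_i <= la_1 + ... + la_j + d min(j, 2)]. Linear inequalities pass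
    to convex combinations, so the Newton polytope is saturated.

    The characterisation is proved by induction on [k], peeling off the last step
    [mu >= nu <= la] of an SSOT, where [d] grows by [r = |mu/nu|]. Necessity is
    bookkeeping with partial sums. For sufficiency, let [s = |la/nu|] be as large as
    [b_k], [la_1] and [la_1 + la_2 + d - max_(i<k) b_i] allow, remove the strip
    [la/nu] as low as possible and put the [b_k - s] boxes of [mu/nu] in the first
    row: this makes the partial sums of [mu] as large as they can be. *)
Require Import Defs.
From mathcomp Require Import all_boot all_order all_algebra.
From mathcomp Require Import boolp classical_sets reals mpoly.
From mathcomp Require Import fsbigop zify.

Import GRing.Theory Num.Theory.

(** * Partial sums of partitions and horizontal strips *)

Definition part_psum (la : intpart) (j : nat) : nat :=
  \sum_(i < j) row_len la i.

Definition interlace (la nu : intpart) : Prop :=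
  forall i, row_len la i.+1 <= row_len nu i <= row_len la i.

Lemma row_len_anti (la : intpart) (i j : nat) :
  i <= j -> row_len la j <= row_len la i.
Proof.
move=> ij; have /andP[la_sorted _] := intpartP la.
have [jla|] := ltnP j (size la); last by move=> ?; rewrite /row_len nth_default.
apply: (@sorted_leq_nth _ geq _ _ 0 la) => //=.
- by move=> x y z /= yx zy; exact: leq_trans zy yx.
- by move=> x /=.
- exact: leq_ltn_trans jla.
Qed.

Lemma intpart_of_fun (f : nat -> nat) (N : nat) :
  (forall i, f i.+1 <= f i) -> f N = 0 -> exists la : intpart, row_len la =1 f.
Proof.
elim: N f => [|N IH] f f_anti fN.
  exists empty_part => i; rewrite /row_len nth_nil.
  by elim: i => [|i IHi]; [rewrite fN | have := f_anti i; lia].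
(* Parts are positive, so a function with [f 0 = 0] must give the empty partition. *)
have [f0|f0] := posnP (f 0).
  exists empty_part => i; rewrite /row_len nth_nil.
  by elim: i => [|i IHi]; [rewrite f0 | have := f_anti i; lia].
have [mu mu_f] := IH (fun i => f i.+1) (fun i => f_anti i.+1) fN.
have /andP[mu_sorted mu0] := intpartP mu.
have la_part : is_intpart (f 0 :: parts mu).
  rewrite /is_intpart inE negb_or mu0 eq_sym -lt0n f0 !andbT /=.
  have := mu_f 0; rewrite /row_len; case: (parts mu) mu_sorted => //= x s -> ->.
  by rewrite f_anti.
by exists (IntPart la_part) => -[|i] //; exact: mu_f.
Qed.

(** If [row_len nu i < row_len la i.+1], rows [i] and [i.+1] of the skew shape both meet column
    [row_len nu i]. *)
Lemma interlaceP (la nu : intpart) :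
  interlace la nu <-> part_incl nu la /\ horizontal_strip la nu.
Proof.
split=> [la_nu|[nu_la strip] i].
  split=> [i|j]; first by case/andP: (la_nu i).
  suff lt_absurd i1 i2 : i1 < i2 -> skew_box la nu i1 j -> skew_box la nu i2 j -> False.
    move=> i1 i2 b1 b2.
    by have [/lt_absurd||] := ltngtP i1 i2 => // [|/lt_absurd]; firstorder.
  move=> i12 /andP[nu_j _] /andP[_ j_la].
  have := row_len_anti la _ _ i12; have /andP[+ _] := la_nu i1; lia.
rewrite nu_la andbT leqNgt; apply/negP => lt_i.
have := strip (row_len nu i) i i.+1; rewrite /skew_box leqnn lt_i.
by have := row_len_anti nu _ _ (leqnSn i); have := row_len_anti la _ _ (leqnSn i); lia.
Qed.

Lemma part_psumS (la : intpart) (j : nat) :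
  part_psum la j.+1 = part_psum la j + row_len la j.
Proof. by rewrite /part_psum big_ord_recr. Qed.

Lemma part_psum0 (la : intpart) : part_psum la 0 = 0.
Proof. by rewrite /part_psum big_ord0. Qed.

Lemma part_psum_size (la : intpart) (N : nat) :
  size la <= N -> part_psum la N = part_size la.
Proof. by move=> laN; rewrite /part_psum /part_size (sumn_nth laN). Qed.

Lemma leq_part_psum (nu la : intpart) (j : nat) :
  part_incl nu la -> part_psum nu j <= part_psum la j.
Proof. by move=> nu_la; apply: leq_sum => i _; exact: nu_la. Qed.

Lemma part_psum_incl (nu mu : intpart) (j : nat) : part_incl nu mu ->
  part_psum mu j + part_size nu <= part_psum nu j + part_size mu.
Proof.
move=> nu_mu.
pose N := maxn (size nu) (size mu).
rewrite -(part_psum_size nu (j + N)) -1?(part_psum_size mu (j + N)); try by lia.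
elim: N => [|N IH]; first by rewrite addn0 addnC.
by rewrite !addnS !part_psumS; have := nu_mu (j + N); lia.
Qed.

(** Row [i.+1] of [la] fits in row [i] of [nu]; summing over [i >= j] compares the two tails. *)
Lemma part_psum_interlace (la nu : intpart) (j : nat) : interlace la nu ->
  part_size la + part_psum nu j <= part_psum la j.+1 + part_size nu.
Proof.
move=> la_nu.
pose N := maxn (size nu) (size la).
rewrite -(part_psum_size nu (j + N)) -1?(part_psum_size la (j + N).+1); try by lia.
elim: N => [|N IH]; first by rewrite addn0.
rewrite !addnS (part_psumS la (j + N).+1) (part_psumS nu).
by have := la_nu (j + N); lia.
Qed.

(* Writing [la_1 >= la_2 >= ...], these inequalities cut out the Minkowski sum of
   the weight polytope of [s_la] (sums over [j] variables at most
   [la_1 + ... + la_j]) and of the polytope of degree sequences of loopless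
   multigraphs with [d] edges (each degree at most [d], the total being [2d]). *)
Definition weight_ineqs (k : nat) (b : nat -> nat) (la : intpart) (d : nat) :=
  forall P : pred nat, \sum_(i < k | P i) b i <=
    part_psum la (\sum_(i < k) P i) + d * minn (\sum_(i < k) P i) 2.

(** For the weight of an SSOT, [d] counts the boxes removed along the way; each is also added,
    whence [d.*2]. *)
Definition ssot_weight (k : nat) (b : nat -> nat) (la : intpart) (d : nat) :=
  \sum_(i < k) b i = part_size la + d.*2 /\ weight_ineqs k b la d.

(** * Necessity of the inequalities *)

(** A box of [mu/nu] can count twice, once in the bound for [mu] and once in [b k], which the growth
    of [d] pays for. When [k] is in the set, the boxes of [la/nu] are paid for by the additional row
    of [la]. *)
Lemma ssot_weight_step k b (mu nu la : intpart) d :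
  interlace mu nu -> interlace la nu ->
  b k = skew_size mu nu + skew_size la nu -> ssot_weight k b mu d ->
  ssot_weight k.+1 b la (d + skew_size mu nu).
Proof.
move=> mu_nu la_nu bk [sum_b ineq_b].
have [nu_mu _] := (interlaceP mu nu).1 mu_nu.
have [nu_la _] := (interlaceP la nu).1 la_nu.
have := part_incl_size nu_mu; have := part_incl_size nu_la.
move: bk; rewrite /skew_size => bk nu_la_size nu_mu_size.
split; first by rewrite big_ord_recr /= sum_b; lia.
move=> P; rewrite big_mkcond !big_ord_recr -big_mkcond /=.
have := ineq_b P; move: (\sum_(i < k) P i) (\sum_(i < k | P i) b i) => c B /= le_B.
have := leq_part_psum nu la c nu_la.
have := part_psum_incl nu mu c nu_mu; have := part_psum_interlace la nu c la_nu.
move: le_B; case: (P k); rewrite ?addn0 ?addn1.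
  by case: c => [|[|c]]; rewrite ?part_psum0; lia.
by case: c => [|[|c]]; rewrite ?part_psum0; lia.
Qed.

Lemma ssot_weight_mult la S k : is_ssot la S ->
  exists d, ssot_weight k (ssot_mult S) (S k).1 d.
Proof.
move=> Sla; elim: k => [|k [d IH]].
  by exists 0; rewrite (ssot_start Sla); split=> [|P /=]; rewrite !big_ord0.
exists (d + skew_size (S k).1 (S k).2); apply: ssot_weight_step IH => //.
  by apply/interlaceP; split; apply Sla.
by apply/interlaceP; split; apply Sla.
Qed.

(** * Strips with extremal partial sums *)

(** For a strip of [s] boxes, [leq_part_psum] and [part_psum_interlace] bound the partial sums of
    [nu] from above; removing the boxes as low as possible attains the smaller bound for every [j]
    at once. *)
Lemma greedy_strip (la : intpart) (s : nat) : s <= row_len la 0 ->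
  exists2 nu, interlace la nu &
    forall j, part_psum nu j = minn (part_psum la j) (part_psum la j.+1 - s).
Proof.
move=> s_la.
pose N j := minn (part_psum la j) (part_psum la j.+1 - s).
have s_le j : s <= part_psum la j.+1.
  by elim: j => [|j IH]; rewrite part_psumS ?part_psum0; lia.
(* [N] is the minimum of two sequences with increments [row_len la j] and [row_len la j.+1], so its
   increment lies between them. By [s_le] the subtraction never truncates. *)
have N_step j : row_len la j.+1 <= N j.+1 - N j <= row_len la j /\ N j <= N j.+1.
  have := s_le j; have := row_len_anti la _ _ (leqnSn j).
  by rewrite /N !part_psumS; lia.
have [||nu nuE] := intpart_of_fun (fun j => N j.+1 - N j) (size la).
- by move=> i; have [/andP[_ +] _] := N_step i.+1; have [/andP[+ _] _] := N_step i; lia.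
- have la0 : row_len la (size la) = 0 by rewrite /row_len nth_default.
  by have [/andP[_ +] _] := N_step (size la); lia.
exists nu => [i|j]; first by rewrite nuE; have [] := N_step i.
rewrite -/(N j); elim: j => [|j IH]; first by rewrite /N !part_psum0; lia.
by rewrite part_psumS IH nuE; have [_] := N_step j; lia.
Qed.

Lemma add_first_row (nu : intpart) (r : nat) :
  exists2 mu, interlace mu nu &
    forall j, part_psum mu j.+1 = part_psum nu j.+1 + r.
Proof.
have [||mu muE] :=
  intpart_of_fun (fun j => row_len nu j + (if j is 0 then r else 0)) (size nu).+1.
- case=> [|i]; first by have := row_len_anti nu 0 1; lia.
  by have := row_len_anti nu i.+1 i.+2; lia.
- by rewrite /row_len nth_default.
exists mu => [i|j].
  by rewrite !muE; have := row_len_anti nu _ _ (leqnSn i); case: i; lia.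
elim: j => [|j IH]; rewrite [LHS]part_psumS muE.
  by rewrite part_psumS !part_psum0; lia.
by rewrite IH (part_psumS nu j.+1); lia.
Qed.

(** * Sums over sets of variables *)

Lemma sum_setU1 (k : nat) (P : pred nat) (F : nat -> nat) (m : nat) :
  m < k -> ~~ P m ->
  \sum_(i < k | (i == m :> nat) || P i) F i = \sum_(i < k | P i) F i + F m.
Proof.
move=> mk Pm; rewrite (bigD1 (Ordinal mk)) ?eqxx //= addnC; congr (_ + _).
apply: eq_bigl => i; rewrite -val_eqE /=.
by have [->|_] := eqVneq (i : nat) m; rewrite ?(negbTE Pm) ?andbT.
Qed.

Lemma count_setU1 (k : nat) (P : pred nat) (m : nat) : m < k -> ~~ P m ->
  \sum_(i < k) ((i == m :> nat) || P i) = (\sum_(i < k) P i).+1.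
Proof.
move=> mk Pm; have := sum_setU1 k P (fun=> 1) m mk Pm.
by rewrite big_mkcond [X in _ = X + _ -> _]big_mkcond /= => ->; rewrite addn1.
Qed.

Lemma leq_sum_count_max (k : nat) (P : pred nat) (b : nat -> nat) :
  \sum_(i < k | P i) b i <= (\sum_(i < k) P i) * \max_(i < k) b i.
Proof.
rewrite big_mkcond big_distrl /=; apply: leq_sum => i _.
by case: (P i); rewrite ?mul1n //; exact: (leq_bigmax i).
Qed.

Lemma weight_ineqs_recr k b la d : weight_ineqs k.+1 b la d ->
  weight_ineqs k b la d /\
  forall P : pred nat, \sum_(i < k | P i) b i + b k <=
    part_psum la (\sum_(i < k) P i).+1 + d * minn (\sum_(i < k) P i).+1 2.
Proof.
move=> ineq_b.
suff recr (e : bool) (P : pred nat) : \sum_(i < k | P i) b i + (if e then b k else 0) <=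
    part_psum la (\sum_(i < k) P i + e) + d * minn (\sum_(i < k) P i + e) 2.
  split=> P; first by have := recr false P; rewrite !addn0.
  by have := recr true P; rewrite addn1.
have := ineq_b (fun i => if i == k then e else P i).
have sum_recr (F : bool -> nat -> nat) :
    \sum_(i < k.+1) F (if i == k :> nat then e else P i) i =
    \sum_(i < k) F (P i) i + F e k.
  rewrite big_ord_recr /= eqxx; congr (_ + _).
  by apply: eq_bigr => i _; rewrite ltn_eqF.
rewrite big_mkcond (sum_recr (fun e i => if e then b i else 0)).
by rewrite (sum_recr (fun e _ => e : nat)) -big_mkcond.
Qed.

(** * Sufficiency of the inequalities *)

Lemma ssot_weight_unstep k b la d : ssot_weight k.+1 b la d ->
  exists mu nu d', [/\ interlace mu nu, interlace la nu,
    b k = skew_size mu nu + skew_size la nu & ssot_weight k b mu d'].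
Proof.
rewrite /ssot_weight big_ord_recr /=.
case=> sum_b /weight_ineqs_recr[ineq_b ineq_bk].
pose B := \max_(i < k) b i.
pose l1 := row_len la 0; pose l2 := row_len la 1.
have l21 : l2 <= l1 by exact: row_len_anti.
have psum1 : part_psum la 1 = l1 by rewrite part_psumS part_psum0.
have psum2 : part_psum la 2 = l1 + l2 by rewrite part_psumS psum1.
have bk_le : b k <= l1 + d.
  have := ineq_bk pred0; rewrite big_pred0 // big1 // psum1; lia.
(* These are the inequalities for [{m}] and [{m, k}], with [b m] maximal; for [k = 0] the empty
   maximum is 0. *)
have B_bound : B <= l1 + d /\ B + b k <= l1 + l2 + d.*2.
  rewrite /B; have [k0|k_gt0] := posnP k.
    by have -> : \max_(i < k) b i = 0; [rewrite k0 big_ord0 | lia].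
  have [|m ->] := @eq_bigmax 'I_k (fun i => b i); first by rewrite card_ord.
  have sum1 : \sum_(i < k | (i == m :> nat) || pred0 (i : nat)) b i = b m.
    by rewrite sum_setU1 // big_pred0.
  have count1 : \sum_(i < k) ((i == m :> nat) || pred0 (i : nat)) = 1.
    by rewrite count_setU1 // big1.
  have := ineq_b (fun i => (i == m) || pred0 i).
  have := ineq_bk (fun i => (i == m) || pred0 i).
  by rewrite sum1 count1 psum1 psum2; lia.
(* The bound on [s + B] comes from single variables: [B] must not exceed [row_len mu 0 + d'], which
   will equal [minn l1 (l1 + l2 - s) + d]. *)
have [s [s_l1 s_bk s_B s_max]] : exists s, [/\ s <= l1, s <= b k, s + B <= l1 + l2 + d &
    [\/ s = l1, s = b k | s + B = l1 + l2 + d]].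
  exists (minn l1 (minn (b k) (l1 + l2 + d - B))).
  split; try lia.
  rewrite /minn; case: ifP => _; first by constructor 1.
  by case: ifP => _; [constructor 2 | constructor 3; lia].
have [nu la_nu nu_psum] := greedy_strip la s s_l1.
have [mu mu_nu mu_psum] := add_first_row nu (b k - s).
pose N := maxn (size nu) (maxn (size mu) (size la)).
have la_size : part_size nu + s = part_size la.
  have := nu_psum N.+1; rewrite !part_psum_size; try lia.
  suff : s <= part_size la by lia.
  rewrite -(part_psum_size la N.+1) /part_psum ?big_ord_recl; last lia.
  by apply: leq_trans s_l1 _; exact: leq_addr.
have mu_size : part_size mu = part_size nu + (b k - s).
  by have := mu_psum N; rewrite !part_psum_size; lia.
have r_le_d : b k - s <= d by case: s_max; lia.
exists mu, nu, (d - (b k - s)); split=> //.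
  by rewrite /skew_size; lia.
split; first lia.
move=> P.
have := leq_sum_count_max k P b; rewrite -/B.
have := ineq_b P; have := ineq_bk P.
(* This is the inequality needed when [s = l1 + l2 + d - B]. *)
have tripleP : 1 < \sum_(i < k) P i -> \sum_(i < k | P i) b i + b k + B <=
    part_psum la (\sum_(i < k) P i) + l1 + l2 + 3 * d.
  move=> c_gt1; have k_gt0 : 0 < k.
    rewrite lt0n; apply/eqP => k0.
    by have : \sum_(i < k) P i = 0; [rewrite k0 big_ord0 | lia].
  have [|m Bm] := @eq_bigmax 'I_k (fun i => b i); first by rewrite card_ord.
  have l2_c : row_len la (\sum_(i < k) P i) <= l2 by apply: row_len_anti; lia.
  have l1_c : row_len la (\sum_(i < k) P i).+1 <= l1 by apply: row_len_anti; lia.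
  have [Pm|Pm] := boolP (P m).
    have := ineq_bk P; rewrite part_psumS (minn_idPr _); last by lia.
    lia.
  have := ineq_bk (fun i => (i == m) || P i).
  rewrite sum_setU1 // count_setU1 // !part_psumS (minn_idPr _); last by lia.
  by rewrite -Bm -/B; lia.
move: tripleP; move: (\sum_(i < k) P i) (\sum_(i < k | P i) b i) => [|[|c]] T.
- by lia.
- by rewrite mu_psum nu_psum psum1 psum2; lia.
(* For a set of [j > 1] variables with sum [T], the goal amounts to
   [T + b k <= part_psum la j + s + 2 * d] and [T + b k <= part_psum la j.+1 + 2 * d]. The second is
   [ineq_bk]; the first follows from [ineq_bk], [ineq_b] or [tripleP], according to the case of
   [s_max]. *)
rewrite (part_psumS la c.+2) !(minn_idPr _) //.
rewrite mu_psum nu_psum (part_psumS la c.+2).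
have : row_len la c.+2 <= l2 by apply: row_len_anti.
by case: s_max; lia.
Qed.

Lemma ssot_of_weight k b la d : ssot_weight k b la d ->
  exists S, [/\ is_ssot la S, forall i, i < k -> ssot_mult S i = b i &
    forall i, k <= i -> S i = (la, la)].
Proof.
elim: k la d => [|k IH] la d.
  rewrite /ssot_weight big_ord0 => -[/esym/eqP].
  rewrite addn_eq0 => /andP[/eqP la0 _] _.
  have -> : la = empty_part.
    by apply: part_incl_eq => [i|]; rewrite /skew_size ?la0 // /row_len nth_nil.
  exists (fun=> (empty_part, empty_part)); split=> //; split=> //=; last by exists 0.
  - by move=> _ j; rewrite leqnn.
  - by move=> _ j; rewrite leqnn.
  - by move=> _ j i1 i2; rewrite /skew_box; lia.
  - by move=> _ j i1 i2; rewrite /skew_box; lia.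
case/ssot_weight_unstep=> mu [nu [d' [mu_nu la_nu bk /IH[S [S_mu S_b S_k]]]]].
have [nu_mu mu_strip] := (interlaceP mu nu).1 mu_nu.
have [nu_la la_strip] := (interlaceP la nu).1 la_nu.
(* [S] is constantly [(mu, mu)] from index [k] on; the last step to [la] through [nu] replaces that
   tail. *)
pose S' i := if i < k then S i else if i == k then (mu, nu) else (la, la).
have S'_lt i : i < k -> S' i = S i by rewrite /S' => ->.
have S'_k : S' k = (mu, nu) by rewrite /S' ltnn eqxx.
have S'_gt i : k < i -> S' i = (la, la).
  by move=> ki; rewrite /S' ltnNge (ltnW ki) gtn_eqF.
have S'_1 i : i <= k -> (S' i).1 = (S i).1.
  by rewrite leq_eqVlt => /predU1P[->|/S'_lt-> //]; rewrite S'_k S_k.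
have la_incl : part_incl la la by move=> i.
have la_la : horizontal_strip la la by move=> j i1 i2; rewrite /skew_box; lia.
exists S'; split.
- split.
  + case: (posnP k) => [k0|k_gt0]; last by rewrite S'_lt // (ssot_start S_mu).
    have mu0 : mu = empty_part by have := ssot_start S_mu; rewrite S_k ?k0 // => -[].
    rewrite -k0 S'_k mu0; congr (_, _); apply/esym/part_incl_eq.
      by rewrite -mu0.
    by rewrite /skew_size.
  + move=> i; have [ik|ki|->] := ltngtP i k; [|by rewrite S'_gt|by rewrite S'_k].
    by rewrite S'_lt //; exact: ssot_down_incl S_mu i.
  + move=> i; have [ik|ki|->] := ltngtP i k; last by rewrite S'_k S'_gt.
      by rewrite S'_1 // S'_lt //; exact: ssot_up_incl S_mu i.
    by rewrite !S'_gt // ltnW.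
  + move=> i; have [ik|ki|->] := ltngtP i k; [|by rewrite S'_gt|by rewrite S'_k].
    by rewrite S'_lt //; exact: ssot_down_strip S_mu i.
  + move=> i; have [ik|ki|->] := ltngtP i k; last by rewrite S'_k S'_gt.
      by rewrite S'_1 // S'_lt //; exact: ssot_up_strip S_mu i.
    by rewrite !S'_gt // ltnW.
  + by exists k.+1 => i /S'_gt.
- move=> i; rewrite ltnS leq_eqVlt => /predU1P[->|ik].
    by rewrite /ssot_mult S'_k S'_gt.
  by rewrite -S_b // /ssot_mult (S'_1 i.+1) // S'_lt.
- by move=> i /S'_gt.
Qed.

(** * The support of the polynomial *)

(** Each SSOT contributes 0 or 1 to a coefficient, so nothing cancels. *)
Lemma mcoeff_ss_poly_neq0 (la : intpart) (n k : nat) (a : 'X_{1..k}) :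
  ((ss_poly la n k)@_a != 0)%R <-> exists2 S, ssot la n S &
    (forall i, k <= i -> ssot_mult S i = 0) /\ forall i : 'I_k, ssot_mult S i = a i.
Proof.
have coefE S : ((ssot_monomial k S)@_a =
    `[< (forall i, k <= i -> ssot_mult S i = 0)%N /\
        forall i : 'I_k, ssot_mult S i = a i >]%:R)%R.
  rewrite /ssot_monomial; case: asboolP => [S0|S0].
    rewrite mcoeffX; congr (nat_of_bool _)%:R%R; apply/eqP/asboolP => [<-|[_ Sa]].
      by split=> // i; rewrite mnmE.
    by apply/mnmP => i; rewrite mnmE.
  by rewrite mcoeff0; case: asboolP => // -[].
rewrite /ss_poly raddf_sum /= Num.Theory.psumr_neq0 => [|S _]; last first.
  by rewrite coefE ler0n.
(* Finiteness ensures that [finite_support] is the true support and not the empty default. *)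
have fin := ssot_monomial_finite la n k.
split=> [/hasP[S]|[S Sn Sa]].
  rewrite in_finite_support // inE => -[Sn _] /=.
  by rewrite coefE; case: asboolP => // Sa _; exists S.
have S1 : ((ssot_monomial k S)@_a = 1)%R by rewrite coefE asboolT.
apply/hasP; exists S; last by rewrite /= S1.
rewrite in_finite_support // inE; split=> //= S0.
by move: S1; rewrite S0 mcoeff0.
Qed.

Lemma eq_ssot_weight k b b' la d : (forall i, i < k -> b i = b' i) ->
  ssot_weight k b la d -> ssot_weight k b' la d.
Proof.
move=> bb' [sum_b ineq_b]; split.
  by rewrite -sum_b; apply: eq_bigr => i _; rewrite bb'.
move=> P; have := ineq_b P; rewrite (eq_bigr (fun i : 'I_k => b' i)) // => i _.
exact: bb'.
Qed.

Definition multinom_fun (k : nat) (a : 'X_{1..k}) (i : nat) : nat :=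
  if insub i is Some j then a j else 0.

Lemma multinom_funE (k : nat) (a : 'X_{1..k}) (i : 'I_k) : multinom_fun k a i = a i.
Proof. by rewrite /multinom_fun valK. Qed.

Lemma ss_poly_weight (la : intpart) (n k d : nat) (a : 'X_{1..k}) :
  n = part_size la + d.*2 ->
  ((ss_poly la n k)@_a != 0)%R <-> ssot_weight k (multinom_fun k a) la d.
Proof.
move=> nE; rewrite mcoeff_ss_poly_neq0; split.
  case=> S [Sla Sn] [S0 Sa]; have [d' wS] := ssot_weight_mult la S k Sla.
  move: wS; rewrite (ssot_stable_ge Sla S0) // => wS.
  (* The length fixes the number of removed boxes. *)
  have dd' : d' = d.
    by have [] := wS; rewrite -(ssot_lengthE Sla S0) Sn nE /=; lia.
  rewrite -dd'; apply: eq_ssot_weight wS => i ik.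
  by rewrite -[i]/(val (Ordinal ik)) multinom_funE -Sa.
move=> wa; have [S [Sla Sa S_k]] := ssot_of_weight _ _ _ _ wa.
have S0 i : k <= i -> ssot_mult S i = 0.
  by move=> ki; rewrite /ssot_mult !S_k ?leqW // /skew_size subnn.
exists S; last by split=> // i; rewrite Sa // multinom_funE.
split=> //; rewrite (ssot_lengthE Sla S0) nE; have [<- _] := wa.
by apply: eq_bigr => i _; rewrite Sa.
Qed.

(** * Passage to convex combinations *)

Lemma convex_comb_le (R : realType) (m : nat) (w x : 'I_m -> R) (c : R) :
  (forall i, 0 <= w i)%R -> (\sum_i w i = 1)%R -> (forall i, x i <= c)%R ->
  (\sum_i w i * x i <= c)%R.
Proof.
move=> w0 w1 xc; rewrite -[leRHS]mul1r -w1 mulr_suml.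
by apply: ler_sum => i _; rewrite ler_wpM2l.
Qed.

Theorem theorem4p19 (R : realType) (la : intpart) (n k : nat)
    (hn : part_size la <= n) (hpar : n = part_size la %[mod 2])
    (hk : 1 <= k) :
  saturated_newton_polytope R (ss_poly la n k).
Proof.
pose d := (n - part_size la)./2.
have nE : n = part_size la + d.*2 by rewrite /d; lia.
rewrite /saturated_newton_polytope; apply/seteqP; split=> x; last first.
  (* A support point is a convex combination with a single term. *)
  case=> a fa <-; split; last by exists a.
  exists 1, (fun=> 1%R), (fun=> exponent_vector R a); split.
  - by move=> _; exact: ler01.
  - exact: (big_ord1 _ (fun=> 1%R)).
  - by move=> _; exists a.
  - by rewrite big_ord1 scale1r.
case=> -[m [w [p [w0 w1 p_supp]]]] -> [a _ aE].
have {p_supp} /choice[q q_supp] : forall i, exists q : 'X_{1..k},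
    (((ss_poly la n k)@_q) != 0)%R /\ exponent_vector R q = p i.
  by move=> i; have [q fq qE] := p_supp i; exists q.
(* A sum of coordinates is a linear functional, so it commutes with the convex combination. *)
have sum_a (P : pred nat) : ((\sum_(j < k | P j) multinom_fun k a j)%:R =
    \sum_i w i * (\sum_(j < k | P j) multinom_fun k (q i) j)%:R :> R)%R.
  rewrite natr_sum; under [RHS]eq_bigr do rewrite natr_sum mulr_sumr.
  rewrite exchange_big; apply: eq_bigr => j _.
  have := congr1 (fun u : 'rV[R]_k => u ord0 j) aE.
  rewrite mxE summxE multinom_funE => ->; apply: eq_bigr => i _.
  by have [_ <-] := q_supp i; rewrite !mxE multinom_funE.
exists a => //=; apply/(ss_poly_weight _ _ _ _ _ nE).
have q_weight i := (ss_poly_weight _ _ _ _ _ nE).1 (q_supp i).1.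
split.
  apply/eqP; rewrite -(eqr_nat R) (sum_a predT); apply/eqP.
  rewrite (eq_bigr (fun i => w i * (part_size la + d.*2)%:R)%R).
    by rewrite -mulr_suml w1 mul1r.
  by move=> i _; have [-> _] := q_weight i.
move=> P; rewrite -(ler_nat R) sum_a; apply: convex_comb_le => // i.
by rewrite ler_nat; have [_] := q_weight i.
Qed.
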